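(* Let $n\ge 1$ be an integer, let $\alpha, c$ be real numbers, and let $CS_n$ be the chain silicate network of dimension $n$. Then $$\Pi_{1,c}(CS_n)=2^{nc-c}\,3^{3nc+c},$$ $$\Pi_2(CS_n)=2^{6n-6}\,3^{12n},$$ $$\chi_\alpha(CS_n)=\begin{cases}6^{\alpha+1}, & n=1,\\ 2^\alpha 3^\alpha(n+4)+3^{2\alpha}(4n-2)+2^{2\alpha}3^\alpha(n-2), & n\ge 2,\end{cases}$$ $$\Pi_1^*(CS_n)=\begin{cases}46656, & n=1,\\ 2^{3n}\,3^{10n-2}, & n\ge 2.\end{cases}$$
   Context: All graphs are finite, simple and connected; $d(v)$ is the degree of the vertex $v$ in $G=(V(G),E(G))$. For real $c,\alpha$ define $$\Pi_{1,c}(G)=\prod_{v\in V(G)}d(v)^c,\quad \Pi_2(G)=\prod_{uv\in E(G)}d(u)d(v)=\prod_{u\in V(G)}d(u)^{d(u)},$$ $$\Pi_1^*(G)=\prod_{uv\in E(G)}(d(u)+d(v)),\quad \chi_\alpha(G)=\sum_{uv\in E(G)}(d(u)+d(v))^\alpha.$$ Chain silicate network $CS_n$: the graph obtained by arranging $n$ tetrahedra linearly. That is, take $n$ copies $T_1,\dots,T_n$ of the complete graph $K_4$ such that for each $1\le i\le n-1$ the copies $T_i$ and $T_{i+1}$ share exactly one vertex, these $n-1$ shared vertices are pairwise distinct, and there are no other identifications. Thus $|V(CS_n)|=3n+1$ and $|E(CS_n)|=6n$. *)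

(* Defs.v *)
From mathcomp Require Import all_boot all_order all_algebra.
From mathcomp Require Import reals exp.
From mathcomp Require Import zify.

Set Implicit Arguments.
Unset Strict Implicit.
Unset Printing Implicit Defensive.

Import Order.TTheory GRing.Theory Num.Theory.

Record graph := Graph {
  vertex :> finType;
  adj : rel vertex;
  adj_sym : symmetric adj;
  adj_irr : irreflexive adj;
  adj_conn : forall u v : vertex, connect adj u v
}.

Section Indices.
Variable G : graph.

Definition deg (v : G) : nat := #|[set u : G | adj v u]|.

Definition edges : {set {set G}} :=
  [set A : {set G} | [exists u : G, [exists v : G, adj u v && (A == [set u; v])]]].

(* The endpoints of an edge uv are the two elements of the set A = {u, v}, so
   d(u)d(v) and d(u) + d(v) are the product and the sum of deg over A. *)

Definition Pi1 (R : realType) (c : R) : R :=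
  (\prod_(v : G) ((deg v)%:R `^ c))%R.

Definition Pi2 : nat := \prod_(A in edges) \prod_(u in A) deg u.

Definition Pi1star : nat := \prod_(A in edges) \sum_(u in A) deg u.

Definition chi (R : realType) (a : R) : R :=
  (\sum_(A in edges) ((\sum_(u in A) deg u)%N%:R `^ a))%R.

End Indices.

(* G is a chain silicate network of dimension n, which determines G up to
   isomorphism.  The shared vertices are pairwise distinct because copies that
   are not consecutive are disjoint. *)
Definition chain_silicate (n : nat) (G : graph) : Prop :=
  exists T : 'I_n -> {set G},
    [/\ forall i, #|T i| = 4,
        forall v : G, exists i, v \in T i,
        forall u v : G, adj u v <-> u <> v /\ exists i, u \in T i /\ v \in T i,
        forall i j : 'I_n, i.+1 = j -> #|T i :&: T j| = 1
      & forall i j : 'I_n, i.+1 < j -> [disjoint T i & T j]].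

Lemma Pi2_vertices (G : graph) : Pi2 G = \prod_(u : G) deg u ^ deg u.
Proof.
rewrite /Pi2 (exchange_big_dep xpredT) //=; apply: eq_bigr => u _.
rewrite prod_nat_const; congr (_ ^ _); rewrite /deg.
rewrite -(card_in_imset (f := fun v => [set u; v])); last first.
  move=> v w; rewrite !inE => uv uw /setP/(_ v).
  rewrite !inE eqxx orbT; case: eqP => [vu|_ /esym /= /eqP //].
  by rewrite vu adj_irr in uv.
apply: eq_card => A; rewrite unfold_in /=; apply/andP/imsetP.
  case; rewrite inE => /existsP[x /existsP[y /andP[xy /eqP->]]].
  rewrite !inE => /orP[] /eqP ux; first by exists y; rewrite ?inE ux.
  by exists x; [rewrite inE ux adj_sym | rewrite ux setUC].
case=> v; rewrite inE => uv ->; split; last by rewrite !inE eqxx.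
by rewrite inE; apply/existsP; exists u; apply/existsP; exists v; rewrite uv /=.
Qed.

Section Model.
Variable n : nat.

(* The k-th tetrahedron of this model is {3k, 3k+1, 3k+2, 3k+3}. *)
Definition tetra (k : 'I_n) : {set 'I_(3 * n).+1} :=
  [set v : 'I_(3 * n).+1 | 3 * k <= v <= 3 * k + 3].

Definition model_adj : rel 'I_(3 * n).+1 :=
  fun u v => (u != v) && [exists k, (u \in tetra k) && (v \in tetra k)].

Lemma model_sym : symmetric model_adj.
Proof.
by move=> u v; rewrite /model_adj eq_sym; under eq_existsb do rewrite andbC.
Qed.

Lemma model_irr : irreflexive model_adj.
Proof. by move=> u; rewrite /model_adj eqxx. Qed.

Lemma model_cover (v : 'I_(3 * n).+1) : 0 < n -> exists k, v \in tetra k.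
Proof.
move=> n0; have lt_k : minn (v %/ 3) n.-1 < n by lia.
by exists (Ordinal lt_k); rewrite inE /=; have := ltn_ord v; lia.
Qed.

Lemma model_conn (u v : 'I_(3 * n).+1) : connect model_adj u v.
Proof.
suff conn0 w : connect model_adj ord0 w.
  apply: connect_trans (conn0 v).
  by rewrite (sym_connect_sym model_sym) conn0.
case: w => m; elim: m => [|m IHm] lt_m.
  by rewrite (_ : Ordinal lt_m = ord0) ?connect0 //; apply: val_inj.
apply: connect_trans (IHm (ltnW lt_m)) (connect1 _).
apply/andP; split; first by rewrite -val_eqE /=; lia.
have lt_k : m %/ 3 < n by lia.
by apply/existsP; exists (Ordinal lt_k); rewrite !inE /=; lia.
Qed.

Definition chain_silicate_model : graph :=
  Graph model_sym model_irr model_conn.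

Lemma card_tetra (k : 'I_n) : #|tetra k| = 4.
Proof.
have lt_f (i : 'I_4) : 3 * k + i < (3 * n).+1.
  by have := ltn_ord k; have := ltn_ord i; lia.
rewrite -[RHS](card_ord 4) -cardsT.
rewrite -(card_imset _ (f := fun i => Ordinal (lt_f i))); last first.
  by move=> i j /(congr1 val) /= ij; apply: val_inj => /=; lia.
apply: eq_card => v; apply/idP/imsetP => [|[i _ ->]]; last first.
  by rewrite inE /=; have := ltn_ord i; lia.
rewrite inE => kv; have lt_i : v - 3 * k < 4 by lia.
by exists (Ordinal lt_i) => //; apply: val_inj => /=; lia.
Qed.

Lemma chain_silicate_exists : 0 < n -> chain_silicate n chain_silicate_model.
Proof.
move=> n0; exists tetra; split.
- exact: card_tetra.
- by move=> v; apply: model_cover.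
- move=> u v; split=> [/andP[/eqP uv /existsP[k /andP[uk vk]]]|[uv [k [uk vk]]]].
    by split=> //; exists k.
  by apply/andP; split; [apply/eqP | apply/existsP; exists k; rewrite uk].
- move=> i j ij; have lt_v : 3 * j < (3 * n).+1 by have := ltn_ord j; lia.
  apply/eqP/cards1P; exists (Ordinal lt_v); apply/setP => w.
  by rewrite !inE -val_eqE /=; lia.
- move=> i j ij; rewrite disjoint_subset; apply/subsetP => w.
  by rewrite !inE; lia.
Qed.

End Model.

(* Main.v *)
Require Import Defs.
From mathcomp Require Import all_boot all_order all_algebra.
From mathcomp Require Import reals exp.
From mathcomp Require Import zify ring.
Import Order.TTheory GRing.Theory Num.Theory.
Local Open Scope ring_scope.


(** Call a vertex lying in two tetrahedra a link, and let S be the set of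
    links.  Write n = m + 1, so that there are m links s_0, ..., s_{m-1}, where
    s_k joins the tetrahedra k and k + 1.

    A vertex in a single tetrahedron sees the three others, and a link sees
    three in each of its two tetrahedra, so a vertex has degree 6 on S and 3
    elsewhere (deg_chain).  Counting incidences between vertices and tetrahedra
    gives |V| + |S| = 4n, hence 3n + 1 vertices (card_vertices).  This settles
    the two indices that are products over vertices.

    For the other two, the degree sum of an edge is 6, 9 or 12 according to the
    number t = 0, 1, 2 of its endpoints in S; let e_t count these edges.  The
    handshake identity, applied to V and to S, gives
      2 (e_0 + e_1 + e_2) = 12 n   and   e_1 + 2 e_2 = 6 m.
    An edge between links joins two consecutive ones, so e_2 = m - 1 when m > 0
    and e_2 = 0 when m = 0 (edge_class2E).  The linear system then determines
    e_0 and e_1 (card_edge_classes); that e_2 is not m - 1 for m = 0 is why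
    n = 1 is a separate case.  It remains to collect powers of 2 and 3. *)

(** * Edges and the handshake identity *)

Section Handshake.
Set Implicit Arguments.
Unset Strict Implicit.
Local Open Scope nat_scope.
Variable G : graph.

Lemma edgesP (A : {set G}) :
  reflect (exists u v, adj u v /\ A = [set u; v]) (A \in edges G).
Proof.
rewrite inE; apply: (iffP existsP) => [[u /existsP[v /andP[uv /eqP->]]]|].
  by exists u, v.
by case=> u [v [uv ->]]; exists u; apply/existsP; exists v; rewrite uv eqxx.
Qed.

Lemma adj_neq (u v : G) : adj u v -> u != v.
Proof. by move=> uv; apply: contraTneq uv => ->; rewrite adj_irr. Qed.

Lemma card_edge (A : {set G}) : A \in edges G -> #|A| = 2.
Proof. by case/edgesP => u [v [/adj_neq uv ->]]; rewrite cards2 uv. Qed.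

Lemma card_incident_edges (u : G) :
  #|[set A in edges G | u \in A]| = deg u.
Proof.
rewrite /deg -(card_in_imset (f := fun v => [set u; v])); last first.
  move=> v w; rewrite !inE => /adj_neq uv /adj_neq uw /setP/(_ v).
  by rewrite !inE eqxx orbT eq_sym (negPf uv) => /esym/eqP.
apply: eq_card => A; rewrite inE; apply/andP/imsetP => [[/edgesP]|].
  case=> x [y [xy ->]]; rewrite !inE => /orP[]/eqP ux.
    by exists y; rewrite ?inE ux.
  by exists x; [rewrite inE ux adj_sym | rewrite ux setUC].
case=> v; rewrite inE => uv ->; rewrite set21; split=> //.
by apply/edgesP; exists u, v.
Qed.

(** Both sides count the pairs of an edge and an endpoint of it in W.  The case
    of a general W makes it usable for the set of links as well as for V. *)
Lemma handshake (W : {set G}) :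
  \sum_(A in edges G) #|A :&: W| = \sum_(u in W) deg u.
Proof.
under eq_bigr => A _ do rewrite -sum1_card.
rewrite (exchange_big_dep (mem W)) /=; last by move=> A u _ /setIP[].
apply: eq_bigr => u uW; rewrite sum1_card -card_incident_edges.
by apply: eq_card => A; rewrite [RHS]inE unfold_in /= in_setI uW andbT.
Qed.

End Handshake.

Lemma sum_mem (I : finType) (A B : {set I}) :
  (\sum_(x in A) (x \in B) = #|A :&: B|)%N.
Proof.
by rewrite -sum1_card big_mkcond [RHS]big_mkcond; apply: eq_bigr => x _;
  rewrite inE; do 2!case: (x \in _).
Qed.

(** * Structure of a chain of tetrahedra *)

(** The chain is described by tetrahedra T 0, ..., T m and links
    s 0, ..., s (m - 1), indexed by natural numbers so that successors of
    indices need no casts. *)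
Section Chain.
Set Implicit Arguments.
Unset Strict Implicit.
Local Open Scope nat_scope.
Variables (G : graph) (m : nat) (T : nat -> {set G}) (s : nat -> G).
Hypothesis card_T : forall k, k <= m -> #|T k| = 4.
Hypothesis cover_T : forall v, exists2 k, k <= m & v \in T k.
Hypothesis adjE : forall u v,
  adj u v <-> u <> v /\ exists2 k, k <= m & u \in T k /\ v \in T k.
Hypothesis link_T : forall k, k < m -> T k :&: T k.+1 = [set s k].
Hypothesis far_T : forall j k, j.+1 < k -> k <= m -> [disjoint T j & T k].

Let S : {set G} := [set s k | k : 'I_m].

Lemma link_inP (v : G) : reflect (exists2 k, k < m & v = s k) (v \in S).
Proof.
apply: (iffP imsetP) => [[k _ ->]|[k km ->]]; first by exists k.
by exists (Ordinal km).
Qed.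

Lemma link_mem (i : nat) : i < m -> (s i \in T i) * (s i \in T i.+1).
Proof.
by move=> /link_T/setP/(_ (s i)); rewrite !inE eqxx => /andP[-> ->].
Qed.

(** Non-consecutive tetrahedra are disjoint, so two tetrahedra that meet are
    consecutive and meet in their link only. *)
Lemma common_vertex (v : G) (j k : nat) : v \in T j -> v \in T k ->
  j < k -> k <= m -> k = j.+1 /\ v = s j.
Proof.
move=> vj vk jk km; have ekj : k = j.+1.
  have [//|/eqP] := eqVneq k j.+1 => ne_kj.
  have /far_T/(_ km)/disjointFr/(_ vj) : j.+1 < k by lia.
  by rewrite vk.
split=> //; have /link_T/setP/(_ v) : j < m by lia.
by rewrite ekj in vk; rewrite !inE vj vk => /esym/eqP.
Qed.

Lemma mem_link (i k : nat) : i < m -> k <= m ->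
  (s i \in T k) = (k == i) || (k == i.+1).
Proof.
move=> im km; have [si si1] := link_mem im.
apply/idP/orP => [sk|[]/eqP-> //].
case: (ltngtP k i) => [ki|ik|->]; last by left.
- by have [] := common_vertex sk si1 _ im; lia.
- by have [-> _] := common_vertex si sk ik km; right.
Qed.

(** The least index of a tetrahedron containing s i is i. *)
Lemma link_inj (i j : nat) : i < m -> j < m -> s i = s j -> i = j.
Proof.
move=> im jm sij.
have := mem_link im (ltnW im); have := mem_link im im.
by rewrite sij !mem_link //; lia.
Qed.

Lemma card_links : #|S| = m.
Proof.
rewrite card_imset ?card_ord // => i j sij; apply: val_inj.
exact: link_inj sij.
Qed.

Lemma unlinked_membership (v : G) (j k : nat) : v \notin S ->
  v \in T j -> v \in T k -> j <= m -> k <= m -> j = k.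
Proof.
move=> vS vj vk jm km; case: (ltngtP j k) => // [jk|kj];
  case/negP: vS; apply/link_inP.
  by have [_ ->] := common_vertex vj vk jk km; exists j => //; lia.
by have [_ ->] := common_vertex vk vj kj jm; exists k => //; lia.
Qed.

Lemma card_memberships (v : G) :
  #|[set k : 'I_m.+1 | v \in T k]| = 1 + (v \in S).
Proof.
have [/link_inP[i im ->]|vS] := boolP (v \in S).
  have im1 : i < m.+1 by lia.
  rewrite (_ : [set k | _] = [set Ordinal im1; Ordinal (im : i.+1 < m.+1)]).
    by rewrite cards2 -val_eqE /=; lia.
  by apply/setP => k; rewrite !inE mem_link // -ltnS.
have [i im vi] := cover_T v; apply/eqP/cards1P.
exists (Ordinal (im : i < m.+1)); apply/setP => k; rewrite !inE -val_eqE /=.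
apply/idP/eqP => [vk|-> //].
by apply: unlinked_membership vS vk vi _ im; rewrite -ltnS.
Qed.

(** Double counting of the pairs (v, k) with v in T k: there are 4 (m + 1) by
    tetrahedra, and |V| + m by vertices. *)
Lemma card_vertices : #|G| = 3 * m + 4.
Proof.
have : \sum_(k < m.+1) #|T k| = \sum_(v in [set: G]) (1 + (v \in S)).
  under [LHS]eq_bigr => k _ do rewrite -sum1_card.
  rewrite (exchange_big_dep (mem [set: G])) //=; apply: eq_bigr => v _.
  by rewrite sum1_card -card_memberships; apply: eq_card => k; rewrite inE.
have -> : \sum_(k < m.+1) #|T k| = \sum_(k < m.+1) 4.
  by apply: eq_bigr => k _; rewrite card_T // -ltnS.
rewrite sum_nat_const card_ord big_split /= sum1_card sum_mem setTI.
by rewrite cardsT card_links; set N := #|_|; lia.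
Qed.

(** The neighbourhood of a link is the union of its two tetrahedra, which has
    4 + 4 - 1 elements, without the link itself; that of any other vertex is the
    rest of its only tetrahedron. *)
Lemma deg_chain (v : G) : deg v = 3 * (1 + (v \in S)).
Proof.
rewrite /deg; have [/link_inP[i im ->]|vS] := boolP (v \in S).
  have [si si1] := link_mem im.
  rewrite (_ : [set u | _] = (T i :|: T i.+1) :\ s i).
    have := cardsD1 (s i) (T i :|: T i.+1).
    by rewrite inE si cardsU link_T // cards1 !card_T; lia.
  apply/setP => u; rewrite !inE; apply/idP/andP.
    case/adjE => /nesym/eqP-> [k km []]; rewrite mem_link //.
    by case/orP => /eqP-> ->; rewrite ?orbT.
  case=> /eqP/nesym us uT; apply/adjE; split=> //.
  by case/orP: uT => uT; [exists i; first lia | exists i.+1].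
have [i im vi] := cover_T v.
rewrite (_ : [set u | _] = T i :\ v).
  by have := cardsD1 v (T i); rewrite vi card_T //; lia.
apply/setP => u; rewrite !inE; apply/idP/andP; last first.
  by case=> /eqP/nesym uv ui; apply/adjE; split=> //; exists i.
case/adjE => /nesym/eqP-> [k km [vk uk]]; split=> //.
by rewrite (unlinked_membership vS vi vk).
Qed.

(** * Edges by number of links *)

Let edge_class (t : nat) : {set {set G}} :=
  [set A in edges G | #|A :&: S| == t].

(** If s i and s j with i < j lie in a common T k, then k is i or i + 1, and
    also j or j + 1; so j = k = i + 1.  For m <= 1 both sides are empty. *)
Lemma edge_class2E :
  edge_class 2 = [set [set s i; s i.+1] | i : 'I_m.-1].
Proof.
apply/setP => A; rewrite inE; apply/andP/imsetP => [[AE /eqP AS]|[i _ ->]].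
  have sAS : A \subset S.
    by apply/setIidPl/eqP; rewrite eqEcard subsetIl AS card_edge.
  case/edgesP: AE sAS => u [v [/adjE[uv [k km [uk vk]]] ->]].
  rewrite subUset !sub1set => /andP[/link_inP[i im ui] /link_inP[j jm vj]].
  move: uv uk vk; rewrite {}ui {}vj !mem_link // => uv ki kj.
  have ne_ij : i <> j by move=> ij; apply: uv; rewrite ij.
  wlog ij : i j im jm ki kj ne_ij {uv} / i < j.
    move=> wl; have [ij|ji|//] := ltngtP i j; first exact: wl.
    by rewrite setUC; apply: wl => //; apply: nesym.
  have im1 : i < m.-1 by lia.
  by exists (Ordinal im1) => //=; congr [set _; s _]; lia.
have im1 := ltn_ord i; have im : i < m by lia.
have i1m : i.+1 < m by lia.
have ne_s : s i != s i.+1 by apply/eqP => /link_inj; lia.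
split.
  apply/edgesP; exists (s i), (s i.+1); split=> //; apply/adjE.
  split; first exact/eqP.
  by exists i.+1 => //; rewrite !mem_link // !eqxx orbT.
rewrite (setIidPl _) ?cards2 ?ne_s //.
by rewrite subUset !sub1set; apply/andP; split; apply/link_inP;
  [exists i | exists i.+1].
Qed.

Lemma card_edge_class2 : #|edge_class 2| = m.-1.
Proof.
rewrite edge_class2E card_imset ?card_ord // => i j /setP eqA; apply: val_inj.
have [lt_i lt_j] := (ltn_ord i, ltn_ord j).
have idx k l : k < m -> l < m -> (s k == s l) = (k == l).
  by move=> km lm; apply/eqP/eqP => [/link_inj->|->].
have := eqA (s i); have := eqA (s i.+1).
by rewrite !inE !idx /=; lia.
Qed.

(** Stated for any commutative operation: it serves for counting edges, for the
    product Pi1star and for the sum chi. *)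
Lemma big_edges_links (M : Type) (idx : M) (op : Monoid.com_law idx)
    (f : nat -> M) :
  \big[op/idx]_(A in edges G) f #|A :&: S| =
    op (iter #|edge_class 0| (op (f 0)) idx)
      (op (iter #|edge_class 1| (op (f 1)) idx)
          (iter #|edge_class 2| (op (f 2)) idx)).
Proof.
have classE t : \big[op/idx]_(A in edges G | #|A :&: S| == t) f #|A :&: S| =
    iter #|edge_class t| (op (f t)) idx.
  rewrite -big_const; apply: eq_big => [A|A /andP[_ /eqP-> //]].
  by rewrite /edge_class inE.
have le2 A : A \in edges G -> #|A :&: S| <= 2.
  by move=> AE; rewrite -(card_edge AE) subset_leq_card ?subsetIl.
rewrite (bigID (fun A => #|A :&: S| == 0)) classE; congr (op _ _).
rewrite (bigID (fun A => #|A :&: S| == 1)) -!classE; congr (op _ _).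
  by apply: eq_bigl => A; case: (A \in _); lia.
by apply: eq_bigl => A; have := le2 A; case: (A \in _) => //= /(_ isT); lia.
Qed.

(** Twice the number of edges is the degree sum 6 m + 3 (2 m + 4) over V, and
    e_1 + 2 e_2 is the degree sum 6 m over S. *)
Lemma card_edge_classes :
  [/\ #|edge_class 0| = if m == 0 then 6 else m + 5,
      #|edge_class 1| = if m == 0 then 0 else 4 * m + 2
    & #|edge_class 2| = m.-1].
Proof.
have sum_class (f : nat -> nat) : \sum_(A in edges G) f #|A :&: S| =
    #|edge_class 0| * f 0 + (#|edge_class 1| * f 1 + #|edge_class 2| * f 2).
  by rewrite big_edges_links !iter_addn_0 ![f _ * _]mulnC.
have e2 := card_edge_class2.
have degS : \sum_(u in S) deg u = 6 * m.
  rewrite -card_links mulnC -sum_nat_const; apply: eq_bigr => u uS.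
  by rewrite deg_chain uS.
have degT : \sum_(u in [set: G]) deg u = 12 * m + 12.
  under eq_bigr do rewrite deg_chain.
  rewrite -big_distrr big_split /= sum1_card sum_mem setTI cardsT.
  by rewrite card_links card_vertices; lia.
have := sum_class id; rewrite handshake degS e2 => eqS.
have : \sum_(A in edges G) #|A :&: [set: G]| = \sum_(A in edges G) 2.
  by apply: eq_bigr => A AE; rewrite setIT card_edge.
rewrite handshake degT (sum_class (fun=> 2)) e2 => eqT.
by split=> //; case: eqP; lia.
Qed.

Lemma big_edges_deg (M : Type) (idx : M) (op : Monoid.com_law idx)
    (f : nat -> M) :
  \big[op/idx]_(A in edges G) f (\sum_(u in A) deg u) =
    if m == 0 then iter 6 (op (f 6)) idx
    else op (iter (m + 5) (op (f 6)) idx)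
      (op (iter (4 * m + 2) (op (f 9)) idx) (iter m.-1 (op (f 12)) idx)).
Proof.
have sumE A : A \in edges G -> \sum_(u in A) deg u = 6 + 3 * #|A :&: S|.
  move=> AE; under eq_bigr do rewrite deg_chain.
  by rewrite -big_distrr big_split /= sum1_card card_edge // sum_mem; lia.
under eq_bigr => A AE do rewrite sumE //.
rewrite (big_edges_links _ (fun t => f (6 + 3 * t))).
by have [-> -> ->] := card_edge_classes; case: eqP => // ->;
  rewrite !Monoid.mulm1.
Qed.

Lemma big_vertices_deg (M : Type) (idx : M) (op : Monoid.com_law idx)
    (f : nat -> M) :
  \big[op/idx]_(v : G) f (deg v) =
    op (iter m (op (f 6)) idx) (iter (2 * m + 4) (op (f 3)) idx).
Proof.
have cardCS : #|~: S| = 2 * m + 4.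
  by have := cardsC S; rewrite card_links card_vertices; lia.
rewrite (bigID (mem S)) -[m in iter m]card_links -cardCS -!big_const.
congr (op _ _); apply: eq_big => v; rewrite ?inE // deg_chain.
  by move=> /= ->.
by move=> /= /negPf->.
Qed.

End Chain.

(** * Topological indices of a chain silicate network *)

Lemma chain_silicate_reindex (m : nat) (G : graph) : chain_silicate m.+1 G ->
  exists (T : nat -> {set G}) (s : nat -> G),
    [/\ forall k, k <= m -> #|T k| = 4,
        forall v, exists2 k, k <= m & v \in T k,
        forall u v, adj u v <->
          u <> v /\ exists2 k, k <= m & u \in T k /\ v \in T k,
        forall k, k < m -> T k :&: T k.+1 = [set s k]
      & forall j k, j.+1 < k -> k <= m -> [disjoint T j & T k]]%N.
Proof.
(* v0 is only a default value, making s total outside of [0, m). *)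
case=> T [cardT coverT adjE link far].
have inordE k : (k <= m)%N -> (inord k : 'I_m.+1) = k :> nat by exact: inordK.
have [v0 _] : exists v0, v0 \in T ord0.
  by apply/set0Pn; rewrite -card_gt0 cardT.
pose T' k := T (inord k).
exists T', (fun k => odflt v0 [pick v in T' k :&: T' k.+1]); split.
- by move=> k _; apply: cardT.
- move=> v; have [i vi] := coverT v; exists i; first by rewrite -ltnS.
  by rewrite /T' inord_val.
- move=> u v; split=> [/adjE[uv [i [ui vi]]]|[uv [k _ [uk vk]]]].
    by split=> //; exists i; rewrite ?/T' ?inord_val // -ltnS.
  by apply/adjE; split=> //; exists (inord k).
- move=> k km; have /link/eqP/cards1P[x Tx] :
    (inord k : 'I_m.+1).+1 = (inord k.+1 : 'I_m.+1)
    by rewrite !inordE ?(ltnW km).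
  rewrite /T' Tx; congr [set _]; case: pickP => [y|/(_ x)].
    by rewrite inE => /eqP.
  by rewrite !inE eqxx.
- by move=> j k jk km; apply: far; rewrite !inordE //; lia.
Qed.

Theorem theorem2p2p1 (R : realType) (n : nat) (alpha c : R) (CS : graph)
    (hn : (1 <= n)%N) (hCS : chain_silicate n CS) :
  [/\ Pi1 CS c = 2 `^ (n%:R * c - c) * 3 `^ (3 * n%:R * c + c),
      Pi2 CS = (2 ^ (6 * n - 6) * 3 ^ (12 * n))%N,
      chi CS alpha =
        (if n == 1%N then 6 `^ (alpha + 1)
         else 2 `^ alpha * 3 `^ alpha * (n%:R + 4)
              + 3 `^ (2 * alpha) * (4 * n%:R - 2)
              + 2 `^ (2 * alpha) * 3 `^ alpha * (n%:R - 2))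
    & Pi1star CS =
        (if n == 1%N then 46656
         else 2 ^ (3 * n) * 3 ^ (10 * n - 2))%N].
Proof.
case: n hn hCS => // m _ /chain_silicate_reindex
  [T [s [cardT coverT adjE linkT farT]]].
have vertexE M idx op f :=
  big_vertices_deg cardT coverT adjE linkT farT (M := M) (idx := idx) op f.
have edgeE M idx op f :=
  big_edges_deg cardT coverT adjE linkT farT (M := M) (idx := idx) op f.
have six : 6 = 2 * 3 :> R by ring.
have nine : 9 = 3 * 3 :> R by ring.
have twelve : 12 = 2 * 2 * 3 :> R by ring.
have powdbl (x : R) : 0 < x -> x `^ (2 * alpha) = x `^ alpha * x `^ alpha.
  by move=> x0; rewrite -powRD ?(gt_eqF x0) ?implybT // -mulr2n mulr_natl.
split.
- rewrite /Pi1 (vertexE _ _ _ (fun d => d%:R `^ c)) !iter_mulr_1 /=.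
  rewrite six powRM ?ler0n // exprMn -mulrA -exprD.
  rewrite -!powR_mulrn ?powR_ge0 // -!powRrM.
  by congr (_ `^ _ * _ `^ _); ring.
- rewrite Pi2_vertices (vertexE _ _ _ (fun d => (d ^ d)%N)) !iter_muln_1 /=.
  rewrite (expnMn 2 3) expnMn -!expnM -mulnA -expnD.
  by congr (2 ^ _ * 3 ^ _)%N; lia.
- rewrite /chi (edgeE _ _ _ (fun d => d%:R `^ alpha)) eqSS !iter_addr_0 /=.
  case: eqP => [_|/eqP m0].
    rewrite powRD ?powRr1 ?ler0n // ?pnatr_eq0 ?implybT //.
    by rewrite mulr_natr.
  have m1 : m.-1%:R = m%:R - 1 :> R by rewrite -subn1 natrB // lt0n.
  rewrite six nine twelve !powRM ?mulr_ge0 // !powdbl // -!(mulr_natr (_ * _)).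
  rewrite m1; ring.
- rewrite /Pi1star (edgeE _ _ _ id) eqSS !iter_muln_1 /=; case: eqP => // m0.
  (* The bases 6, 9 and 12 split as 2 * 3, 3 ^ 2 and 2 ^ 2 * 3. *)
  rewrite (expnMn 2 3) -(expnM 3 2) (expnMn 4 3) -(expnM 2 2).
  rewrite [(3 ^ _ * _)%N]mulnCA mulnACA -!expnD.
  by congr (2 ^ _ * 3 ^ _)%N; lia.
Qed.
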